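(* Let $n\ge1$, let $\Omega$ be a domain in $\mathbb C^n$ and let $G\colon\mathbb B^n\to\Omega$ be a biholomorphism which is the restriction to the unit ball $\mathbb B^n=\{z\in\mathbb C^n:|z|<1\}$ of a Möbius transformation. Let $\omega_\Omega=\sqrt{-1}\sum_{i,j=1}^n g_{i\bar j}\,dz_i\wedge d\bar z_j$ be the complete Kähler--Einstein metric on $\Omega$ with Ricci curvature $-1$. Suppose that $\|\partial\log\det(g_{i\bar j})\|_{\omega_\Omega}$ is constant on $\Omega$. Then $\Omega$ and $G$ are affine equivalent to $\mathbb H^n$ and to the Cayley transform $\mathcal C$, respectively; that is, there exist an invertible complex affine map $A\colon\mathbb C^n\to\mathbb C^n$ and a unitary map $U$ of $\mathbb C^n$ such that $A(\Omega)=\mathbb H^n$ and $A\circ G\circ U=\mathcal C$ on $\mathbb B^n$.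
   Context: $\mathbb H^n=\{w\in\mathbb C^n:\operatorname{Re}w_n>|w_1|^2+\dots+|w_{n-1}|^2\}$ and $\mathcal C\colon\mathbb B^n\to\mathbb H^n$ is the Cayley transform $\mathcal C(z)=\left(\frac{z_1}{1-z_n},\dots,\frac{z_{n-1}}{1-z_n},\frac{1+z_n}{1-z_n}\right)$, a biholomorphism. A Möbius transformation is the expression in the affine chart $\mathbb C^n\hookrightarrow\mathbb{CP}^n$, $(z_1,\dots,z_n)\mapsto[z_1,\dots,z_n,1]$, of a projective linear automorphism of $\mathbb{CP}^n$ given by an invertible $(n+1)\times(n+1)$ matrix $(A_{ij})$: its $i$-th component is $\frac{\sum_{j=1}^nA_{ij}z_j+A_{i,n+1}}{\sum_{j=1}^nA_{n+1,j}z_j+A_{n+1,n+1}}$, $1\le i\le n$. The metric $\omega_\Omega$ corresponds under $G$ to the Bergman metric $-(n+1)\sqrt{-1}\,\partial\bar\partial\log(1-|z|^2)$ of $\mathbb B^n$, i.e. $G^*\omega_\Omega$ equals that metric. For real $\eta$, $\|\partial\eta\|_{\omega_\Omega}^2=\sum_{k,j}g^{k\bar j}\frac{\partial\eta}{\partial z_k}\frac{\partial\eta}{\partial\bar z_j}$, where $\sum_j g_{i\bar j}g^{k\bar j}=\delta_{ik}$. *)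

(* Defs.v *)
From HB Require Import structures.
From mathcomp Require Import all_boot all_order all_algebra.
From mathcomp Require Import all_classical all_reals all_analysis.
From mathcomp Require Import complex.

Set Implicit Arguments.
Unset Strict Implicit.
Unset Printing Implicit Defensive.

Import Order.TTheory GRing.Theory Num.Theory numFieldNormedType.Exports.

Local Open Scope classical_set_scope.
Local Open Scope ring_scope.
Local Open Scope complex_scope.

(* R[i] normed over itself; this is what makes 'cV[R[i]]_m a normed module
   over R[i], for which [differentiable] means complex differentiable. *)
HB.instance Definition _ (R : realType) :=
  NormedModule.copy R[i] (R[i] : numClosedFieldType)^o.

Section Wirtinger.
Context {R : realType} {m : nat}.
Implicit Types (f : 'cV[R[i]]_m -> R[i]) (v z : 'cV[R[i]]_m).

(* Derivative of f at z along v with respect to a real parameter. *)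
Definition rderive v f z : R[i] :=
  derive1 (fun t : R => complex.Re (f (z + t%:C *: v))) 0
  +i* derive1 (fun t : R => complex.Im (f (z + t%:C *: v))) 0.

Definition rderivable v f z : Prop :=
  derivable (fun t : R => complex.Re (f (z + t%:C *: v))) 0 1 /\
  derivable (fun t : R => complex.Im (f (z + t%:C *: v))) 0 1.

(* C^oo on an open set D: all iterated real directional derivatives exist and
   are continuous on D. *)
Definition smooth_on (D : set 'cV[R[i]]_m) f : Prop :=
  forall (vs : seq 'cV[R[i]]_m) v z, D z ->
    {for z, continuous (foldr rderive f vs)} /\
    rderivable v (foldr rderive f vs) z.

(* d/dz_k = (d/dx_k - i d/dy_k) / 2 and d/dzbar_k = (d/dx_k + i d/dy_k) / 2 *)
Definition dz (k : 'I_m) f z : R[i] :=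
  (rderive (delta_mx k 0) f z - 'i%C * rderive ('i%C *: delta_mx k 0) f z) / 2.

Definition dzbar (k : 'I_m) f z : R[i] :=
  (rderive (delta_mx k 0) f z + 'i%C * rderive ('i%C *: delta_mx k 0) f z) / 2.

End Wirtinger.

Section Domains.
Context {R : realType}.

Definition sqnorm (m : nat) (z : 'cV[R[i]]_m) : R :=
  \sum_i ((complex.Re (z i 0)) ^+ 2 + (complex.Im (z i 0)) ^+ 2).

Definition unit_ball (m : nat) : set 'cV[R[i]]_m := [set z | sqnorm z < 1].

Definition is_domain (m : nat) (D : set 'cV[R[i]]_m) : Prop :=
  [/\ open D, connected D & D !=set0].

Definition holomorphic_on (m : nat) (D : set 'cV[R[i]]_m)
    (F : 'cV[R[i]]_m -> 'cV[R[i]]_m) : Prop :=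
  forall z, D z -> differentiable F z.

Definition biholomorphism (m : nat) (D E : set 'cV[R[i]]_m)
    (F : 'cV[R[i]]_m -> 'cV[R[i]]_m) : Prop :=
  [/\ set_bij D E F, holomorphic_on D F &
      exists2 H, holomorphic_on E H & {in D, cancel F H}].

(* M acts on the homogeneous coordinates [z_1, ..., z_m, 1]. *)
Definition mobius_num (m : nat) (M : 'M[R[i]]_(m + 1)) (z : 'cV[R[i]]_m)
  : 'cV[R[i]]_m := usubmx (M *m col_mx z 1%:M).

Definition mobius_den (m : nat) (M : 'M[R[i]]_(m + 1)) (z : 'cV[R[i]]_m)
  : R[i] := (M *m col_mx z 1%:M) (rshift m 0) 0.

Definition mobius (m : nat) (M : 'M[R[i]]_(m + 1)) (z : 'cV[R[i]]_m)
  : 'cV[R[i]]_m := \col_i (mobius_num M z i 0 / mobius_den M z).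

(* F agrees on D with a Moebius transformation defined on D; since _ / 0 = 0,
   the absence of poles in D has to be required explicitly. *)
Definition mobius_on (m : nat) (D : set 'cV[R[i]]_m)
    (F : 'cV[R[i]]_m -> 'cV[R[i]]_m) : Prop :=
  exists2 M : 'M[R[i]]_(m + 1), M \in unitmx &
    forall z, D z -> mobius_den M z != 0 /\ F z = mobius M z.

(* In dimension n.+1 the distinguished last coordinate has index [ord_max]. *)
Definition siegel (n : nat) : set 'cV[R[i]]_n.+1 :=
  [set w | \sum_(i < n.+1 | i != ord_max)
             ((complex.Re (w i 0)) ^+ 2 + (complex.Im (w i 0)) ^+ 2)
           < complex.Re (w ord_max 0)].

Definition cayley (n : nat) (z : 'cV[R[i]]_n.+1) : 'cV[R[i]]_n.+1 :=
  \col_i ((if i == ord_max then 1 + z ord_max 0 else z i 0)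
          / (1 - z ord_max 0)).

End Domains.

(* A metric sqrt(-1) \sum_(i, j) g_ij dz_i /\ dzbar_j is given by the matrix
   field g, with (g z) i j the coefficient g_{i jbar} at z. *)
Section Metrics.
Context {R : realType} {m : nat}.
Implicit Types (D : set 'cV[R[i]]_m) (g : 'cV[R[i]]_m -> 'M[R[i]]_m).

Definition sqlength g (z v : 'cV[R[i]]_m) : R[i] :=
  \sum_i \sum_j g z i j * v i 0 * (v j 0)^*.

(* The last clause is the closedness of the fundamental form. *)
Definition kahler_metric D g : Prop :=
  [/\ forall i j, smooth_on D (fun z => g z i j),
      forall z, D z -> forall i j, g z j i = (g z i j)^*,
      forall z, D z -> forall v, v != 0 -> 0 < sqlength g z v &
      forall z, D z -> forall i j k,
        dz k (fun w => g w i j) z = dz i (fun w => g w k j) z].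

(* det g is real and positive for a Kaehler metric g. *)
Definition logdet g (z : 'cV[R[i]]_m) : R[i] :=
  (ln (complex.Re (\det (g z))))%:C.

Definition ricci g (z : 'cV[R[i]]_m) : 'M[R[i]]_m :=
  \matrix_(i, j) - dz i (dzbar j (logdet g)) z.

Definition velocity (c : R -> 'cV[R[i]]_m) (t : R) : 'cV[R[i]]_m :=
  \col_i (derive1 (fun s => complex.Re (c s i 0)) t
          +i* derive1 (fun s => complex.Im (c s i 0)) t).

(* C^1 on all of R; only the restriction to [0, 1] matters below. *)
Definition C1_curve (c : R -> 'cV[R[i]]_m) : Prop :=
  forall i,
    [/\ forall t, derivable (fun s => complex.Re (c s i 0)) t 1,
        forall t, derivable (fun s => complex.Im (c s i 0)) t 1,
        continuous (derive1 (fun s => complex.Re (c s i 0))) &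
        continuous (derive1 (fun s => complex.Im (c s i 0)))].

Definition curve_length g (c : R -> 'cV[R[i]]_m) : \bar R :=
  (\int[lebesgue_measure]_(t in `[0%R, 1%R])
     (Num.sqrt (complex.Re (sqlength g (c t) (velocity c t))))%:E)%E.

(* Distance of the metric, up to the normalization of the associated
   Riemannian metric (a constant factor, irrelevant to completeness). *)
Definition metric_dist D g (a b : 'cV[R[i]]_m) : \bar R :=
  ereal_inf [set curve_length g c | c in
    [set c | [/\ C1_curve c, c 0 = a, c 1 = b &
                 forall t, 0 <= t <= 1 -> D (c t)]]].

Definition complete_metric D g : Prop :=
  forall u : nat -> 'cV[R[i]]_m, (forall k, D (u k)) ->
    (forall e : R, 0 < e -> exists N : nat, forall k l : nat,
       (N <= k)%N -> (N <= l)%N -> (metric_dist D g (u k) (u l) < e%:E)%E) ->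
    exists2 a, D a &
      forall e : R, 0 < e -> exists N : nat, forall k : nat,
        (N <= k)%N -> (metric_dist D g (u k) a < e%:E)%E.

(* Complete Kaehler-Einstein metric with Ric = - omega. *)
Definition complete_kahler_einstein D g : Prop :=
  [/\ kahler_metric D g, forall z, D z -> ricci g z = - g z &
      complete_metric D g].

Definition pullback (F : 'cV[R[i]]_m -> 'cV[R[i]]_m) g (z : 'cV[R[i]]_m)
  : 'M[R[i]]_m :=
  \matrix_(i, j) \sum_k \sum_l
    g (F z) k l * dz i (fun w => F w k 0) z * (dz j (fun w => F w l 0) z)^*.

Definition bergman_ball (z : 'cV[R[i]]_m) : 'M[R[i]]_m :=
  \matrix_(i, j)
    (- (m.+1)%:R * dz i (dzbar j (fun w => (ln (1 - sqnorm w))%:C)) z).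

(* g^{k jbar} is the (k, j) entry of the transpose of the inverse of g. *)
Definition sqnorm_d g (eta : 'cV[R[i]]_m -> R[i]) (z : 'cV[R[i]]_m) : R[i] :=
  \sum_k \sum_j (invmx (g z))^T k j * dz k eta z * dzbar j eta z.

Definition norm_d g (eta : 'cV[R[i]]_m -> R[i]) (z : 'cV[R[i]]_m) : R[i] :=
  sqrtC (sqnorm_d g eta z).

End Metrics.

(* Main.v *)
(** Let [M] be the matrix of [G] and [(c, d)] its last row, so that [q z = c.z + d] is the
denominator of [G].  Write [s z = 1 - |z|^2], and [m] for the dimension.  Since
[det G' = det M / q^(m+1)], the determinant of the metric is a constant times
[(|q|^2 / s)^(m+1)], and [s / |q|^2] is the pullback under [G] of the explicit Hermitian
polynomial [rho].  Hence [log det g] is known on [Omega], and pulling its gradient back to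
the ball gives [|d log det g|^2 = (m+1) (1 + s (|c|^2 - |d|^2) / |q|^2)].
If this is constant and [|c| <> |d|] then [|d|^2 s = |q|^2]; adding the values at [z] and
[-z] gives [- |d|^2 |z|^2 = |c.z|^2], which is absurd.  So [|c| = |d|], and a unitary change
of variables turns [q] into [d (1 - z_m)], the denominator of the Cayley transform up to a
constant; two Moebius maps with the same denominator differ by an affine map. *)

Require Import Defs.
From HB Require Import structures.
From mathcomp Require Import all_boot all_order all_algebra.
From mathcomp Require Import all_classical all_reals all_analysis.
From mathcomp Require Import complex ring spectral.
Import Order.TTheory GRing.Theory Num.Theory numFieldNormedType.Exports.
Local Open Scope classical_set_scope.
Local Open Scope ring_scope.
Local Open Scope complex_scope.

Set Implicit Arguments.
Unset Strict Implicit.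
Unset Printing Implicit Defensive.

(** * Wirtinger calculus *)

Section CurveCalculus.
Context {R : realType}.
Implicit Types (h k : R -> R[i]) (l : R[i]).

(** Real and imaginary parts are kept apart, as in [rderive]; [is_derive] asserts existence together
    with the value. *)
Definition has_curve_derive h l : Prop :=
  is_derive (0 : R) (1 : R) (fun t => complex.Re (h t)) (complex.Re l) /\
  is_derive (0 : R) (1 : R) (fun t => complex.Im (h t)) (complex.Im l).

Lemma ReD (x y : R[i]) : complex.Re (x + y) = complex.Re x + complex.Re y.
Proof. by case: x => ? ?; case: y. Qed.

Lemma ImD (x y : R[i]) : complex.Im (x + y) = complex.Im x + complex.Im y.
Proof. by case: x => ? ?; case: y. Qed.

Lemma ReM (x y : R[i]) : complex.Re (x * y) =
  complex.Re x * complex.Re y - complex.Im x * complex.Im y.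
Proof. by case: x => ? ?; case: y. Qed.

Lemma ImM (x y : R[i]) : complex.Im (x * y) =
  complex.Re x * complex.Im y + complex.Im x * complex.Re y.
Proof. by case: x => ? ?; case: y. Qed.

Lemma curve_derive_cst c : has_curve_derive (fun=> c) 0.
Proof. by split; exact: is_derive_cst. Qed.

Lemma curve_derive_real : has_curve_derive (fun t => t%:C) 1.
Proof. split; [exact: is_derive_id | exact: is_derive_cst]. Qed.

Lemma curve_deriveD h k l l' : has_curve_derive h l -> has_curve_derive k l' ->
  has_curve_derive (fun t => h t + k t) (l + l').
Proof.
move=> [h1 h2] [k1 k2]; split.
  by rewrite ReD; under eq_fun do rewrite ReD; exact: is_deriveD.
by rewrite ImD; under eq_fun do rewrite ImD; exact: is_deriveD.
Qed.

Lemma curve_deriveM h k l l' : has_curve_derive h l -> has_curve_derive k l' ->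
  has_curve_derive (fun t => h t * k t) (h 0 * l' + k 0 * l).
Proof.
move=> [h1 h2] [k1 k2]; split.
  under eq_fun do rewrite ReM.
  have H1 := is_deriveM h1 k1. have H2 := is_deriveM h2 k2.
  have H := is_deriveB H1 H2.
  apply: is_derive_eq H _.
  by rewrite ReD !ReM /GRing.scale /= opprD addrACA.
under eq_fun do rewrite ImM.
have H1 := is_deriveM h1 k2. have H2 := is_deriveM h2 k1.
have H := is_deriveD H1 H2.
apply: is_derive_eq H _.
rewrite ImD !ImM /GRing.scale /=.
rewrite [_ * _ + complex.Im (k 0) * _]addrC.
by rewrite addrACA [X in _ + X]addrC addrACA; congr (_ + _); rewrite addrC.
Qed.

Lemma curve_derive_conj h l : has_curve_derive h l ->
  has_curve_derive (fun t => (h t)^*%C) (l^*%C).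
Proof.
have Rec (x : R[i]) : complex.Re (x^*%C) = complex.Re x by case: x.
have Imc (x : R[i]) : complex.Im (x^*%C) = - complex.Im x by case: x.
move=> [h1 h2]; split.
  by rewrite Rec; under eq_fun do rewrite Rec.
by rewrite Imc; under eq_fun do rewrite Imc; exact: is_deriveN.
Qed.

Lemma curve_derive_realV (u : R -> R) du : u 0 != 0 ->
  is_derive (0 : R) (1 : R) u du ->
  has_curve_derive (fun t => (u t)^-1%:C) (- (u 0) ^- 2 * du)%:C.
Proof.
move=> u0 du0; split; last exact: is_derive_cst.
exact: is_deriveV.
Qed.

Lemma curve_derive_near h k l : (\forall t \near (0 : R), h t = k t) ->
  has_curve_derive h l -> has_curve_derive k l.
Proof.
move=> hk [h1 h2]; split.
  by apply: near_eq_is_derive h1; apply: filterS hk => t /= ->.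
by apply: near_eq_is_derive h2; apply: filterS hk => t /= ->.
Qed.

Lemma curve_derive_continuous h l : has_curve_derive h l ->
  {for 0, continuous (fun t => complex.Re (h t))} /\
  {for 0, continuous (fun t => complex.Im (h t))}.
Proof.
move=> [[h1 _] [h2 _]]; split; apply: differentiable_continuous.
  by apply/derivable1_diffP.
by apply/derivable1_diffP.
Qed.

(** Since [1 / h] is the conjugate of [h] over [|h|^2], only the inverse of the real function
    [u = |h|^2] has to be differentiated. *)
Lemma curve_deriveV h l : h 0 != 0 -> has_curve_derive h l ->
  has_curve_derive (fun t => (h t)^-1) (- l / (h 0) ^+ 2).
Proof.
move=> h0 hl.
pose u t := complex.Re (h t) ^+ 2 + complex.Im (h t) ^+ 2.
have uE t : (u t)%:C = h t * (h t)^*%C.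
  rewrite /u; case: (h t) => a b; apply/eqP.
  by rewrite eq_complex /=; apply/andP; split; apply/eqP; ring.
have u0 : u 0 != 0.
  apply: contraNneq h0 => u0; have := uE 0.
  by rewrite u0 => /esym/eqP; rewrite mulf_eq0 conjc_eq0 orbb.
have hu := curve_deriveM hl (curve_derive_conj hl).
set lu := (X in has_curve_derive _ X) in hu.
have [hu1 _] : has_curve_derive (fun t => (u t)%:C) lu.
  by under eq_fun do rewrite uE.
have luR : lu = (complex.Re lu)%:C.
  rewrite /lu [_ * l]mulrC; case: (h 0) => a b; case: (l) => c d.
  by apply/eqP; rewrite eq_complex /= eqxx /=; apply/eqP; ring.
have hv := curve_deriveM (curve_derive_conj hl) (curve_derive_realV u0 hu1).
move: hv => /=.
have -> : (fun t => (h t)^*%C * ((u t)^-1)%:C) = (fun t => (h t)^-1).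
  (* Away from [0] the curve may meet a zero of [h]; both sides then vanish because [0^-1 = 0]. *)
  apply/funext => t; have [ht|ht] := eqVneq (h t) 0.
    by rewrite ht invr0 rmorph0 mul0r.
  rewrite fmorphV /= uE invfM mulrCA divff ?mulr1 // conjc_eq0 //.
suff -> : (h 0)^*%C * (- u 0 ^- 2 * complex.Re lu)%:C + (u 0)^-1%:C * l^*%C = - l / h 0 ^+ 2 by [].
have -> : (- u 0 ^- 2 * complex.Re lu)%:C = - (u 0)%:C ^- 2 * lu.
  by rewrite [in RHS]luR rmorphM rmorphN fmorphV rmorphXn.
rewrite fmorphV /= uE.
have key (x xc y yc r : R[i]) : x != 0 -> xc != 0 -> r = x * yc + xc * y ->
    xc * (- (x * xc) ^- 2 * r) + (x * xc)^-1 * yc = - y / x ^+ 2.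
  by move=> x0 xc0 ->; field; rewrite x0 xc0.
by apply: key => //; rewrite conjc_eq0.
Qed.

Lemma curve_derive_ln h l : 0 < complex.Re (h 0) -> has_curve_derive h l ->
  has_curve_derive (fun t => (ln (complex.Re (h t)))%:C)
    ((complex.Re l) / complex.Re (h 0))%:C.
Proof.
move=> h0 [hl _]; split; last exact: is_derive_cst.
rewrite mulrC; apply: (@is_derive1_comp _ (@ln R) (fun t => complex.Re (h t))) hl.
exact: is_derive1_ln.
Qed.

End CurveCalculus.

(** * Linear and antilinear parts of the real differential *)

Section Wirtinger.
Context {R : realType} {m : nat}.
Implicit Types (f : 'cV[R[i]]_m -> R[i]) (z v : 'cV[R[i]]_m) (a b : 'I_m -> R[i]).

(* The real differential of f at z is split into its C-linear part a (the d/dz_k) and its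
   antilinear part b (the d/dzbar_k).  Conjugation is written ^*%C throughout, because
   under a big operator a bare ^* is parsed as [Num.conj] instead of [conjc]. *)
Definition has_wirtinger f z a b : Prop := forall v,
  has_curve_derive (fun t : R => f (z + t%:C *: v))
    (\sum_k a k * v k 0 + \sum_k b k * (v k 0)^*%C).

Lemma rderiveE f z v l : has_curve_derive (fun t : R => f (z + t%:C *: v)) l ->
  rderive v f z = l.
Proof.
move=> [[_ h1] [_ h2]]; rewrite /rderive !derive1E h1 h2.
by case: l {h1 h2}.
Qed.

Lemma wirtinger_rderive f z a b v : has_wirtinger f z a b ->
  rderive v f z = \sum_k a k * v k 0 + \sum_k b k * (v k 0)^*%C.
Proof. by move=> h; exact: rderiveE. Qed.

Lemma sum_delta a (c : R[i]) k :
  \sum_j a j * (c *: delta_mx k 0 : 'cV[R[i]]_m) j 0 = c * a k.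
Proof.
rewrite (bigD1 k) //= !mxE !eqxx mulr1 big1 ?addr0 1?mulrC // => j /negPf jk.
by rewrite !mxE jk mulr0 mulr0.
Qed.

Lemma sum_deltaC a (c : R[i]) k :
  \sum_j a j * ((c *: delta_mx k 0 : 'cV[R[i]]_m) j 0)^*%C = c^*%C * a k.
Proof.
rewrite (bigD1 k) //= !mxE !eqxx mulr1 big1 ?addr0 1?mulrC // => j /negPf jk.
by rewrite !mxE jk mulr0 rmorph0 mulr0.
Qed.

Lemma conjc_i : ('i%C : R[i])^*%C = - 'i%C.
Proof. by apply/eqP; rewrite eq_complex /= oppr0 !eqxx. Qed.

(** Along [e_k] and [i e_k] the differential takes the values [a k + b k] and [i (a k - b k)]. *)
Lemma dz_wirtinger f z a b k : has_wirtinger f z a b -> dz k f z = a k.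
Proof.
move=> h; rewrite /dz !(wirtinger_rderive _ h) -[delta_mx k 0]scale1r scalerA mulr1.
rewrite !sum_delta !sum_deltaC conjc_i rmorph1 !mul1r mulrDr mulNr mulrN !mulrA.
rewrite -expr2 sqr_i !mulN1r opprK [- a k + _]addrC opprB addrACA subrr addr0.
by field.
Qed.

Lemma dzbar_wirtinger f z a b k : has_wirtinger f z a b -> dzbar k f z = b k.
Proof.
move=> h; rewrite /dzbar !(wirtinger_rderive _ h) -[delta_mx k 0]scale1r scalerA mulr1.
rewrite !sum_delta !sum_deltaC conjc_i rmorph1 !mul1r mulrDr mulNr mulrN !mulrA.
rewrite -expr2 sqr_i !mulN1r opprK addrACA subrr add0r.
by field.
Qed.

Lemma wirtinger_eq {f z a b a' b'} : has_wirtinger f z a b ->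
  a =1 a' -> b =1 b' -> has_wirtinger f z a' b'.
Proof. by move=> h /funext <- /funext <-. Qed.

(** This lets a formula valid only on the ball or on [Omega] be differentiated there; agreement
    along each real line through [z] is enough, with no uniformity in [v]. *)
Lemma wirtinger_near f g z a b :
  (forall v, \forall t \near (0 : R), f (z + t%:C *: v) = g (z + t%:C *: v)) ->
  has_wirtinger f z a b -> has_wirtinger g z a b.
Proof. by move=> fg h v; apply: curve_derive_near (fg v) (h v). Qed.

Lemma wirtinger_cst c z : has_wirtinger (fun=> c) z (fun=> 0) (fun=> 0).
Proof.
move=> v; rewrite !big1 ?addr0 => [|k _|k _]; rewrite ?mul0r //.
exact: curve_derive_cst.
Qed.

Lemma wirtinger_coord j z :
  has_wirtinger (fun w => w j 0) z (fun k => (j == k)%:R) (fun=> 0).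
Proof.
move=> v.
rewrite (bigD1 j) //= eqxx mul1r !big1 => [|k _|k /negPf jk]; last 2 first.
- by rewrite mul0r.
- by rewrite eq_sym jk mul0r.
under eq_fun do rewrite !mxE.
have := curve_deriveD (curve_derive_cst (z j 0))
  (curve_deriveM curve_derive_real (curve_derive_cst (v j 0))).
by rewrite !mulr0 !addr0 !add0r mulr1.
Qed.

Lemma wirtingerD f g z a b a' b' :
  has_wirtinger f z a b -> has_wirtinger g z a' b' ->
  has_wirtinger (fun w => f w + g w) z (fun k => a k + a' k) (fun k => b k + b' k).
Proof.
move=> hf hg v; have := curve_deriveD (hf v) (hg v).
under [X in _ -> has_curve_derive _ (X + _)]eq_bigr do rewrite mulrDl.
under [X in _ -> has_curve_derive _ (_ + X)]eq_bigr do rewrite mulrDl.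
by rewrite !big_split /= addrACA.
Qed.

Lemma wirtingerM f g z a b a' b' :
  has_wirtinger f z a b -> has_wirtinger g z a' b' ->
  has_wirtinger (fun w => f w * g w) z
    (fun k => f z * a' k + g z * a k) (fun k => f z * b' k + g z * b k).
Proof.
move=> hf hg v; have := curve_deriveM (hf v) (hg v).
under [X in _ -> has_curve_derive _ (X + _)]eq_bigr do rewrite mulrDl -!mulrA.
under [X in _ -> has_curve_derive _ (_ + X)]eq_bigr do rewrite mulrDl -!mulrA.
by rewrite !big_split /= -!mulr_sumr scale0r addr0 !mulrDr addrACA.
Qed.

Lemma wirtinger_conj f z a b : has_wirtinger f z a b ->
  has_wirtinger (fun w => (f w)^*%C) z (fun k => (b k)^*%C) (fun k => (a k)^*%C).
Proof.
move=> hf v; have := curve_derive_conj (hf v).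
rewrite rmorphD !rmorph_sum /= addrC.
under eq_bigr do rewrite rmorphM /= conjcK.
by under [X in _ + X]eq_bigr do rewrite rmorphM /=.
Qed.

Lemma wirtinger_cstM c f z a b : has_wirtinger f z a b ->
  has_wirtinger (fun w => c * f w) z (fun k => c * a k) (fun k => c * b k).
Proof.
move=> hf; apply: (wirtinger_eq (wirtingerM (wirtinger_cst c z) hf)).
  by move=> k /=; rewrite mulr0 addr0.
by move=> k /=; rewrite mulr0 addr0.
Qed.

Lemma wirtinger_normsq f z a : has_wirtinger f z a (fun=> 0) ->
  has_wirtinger (fun w => f w * (f w)^*%C) z
    (fun k => (f z)^*%C * a k) (fun k => f z * (a k)^*%C).
Proof.
move=> hf.
apply: (wirtinger_eq (wirtingerM hf (wirtinger_conj hf))) => k.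
  by cbv beta; rewrite rmorph0 mulr0 add0r.
by cbv beta; rewrite mulr0 addr0.
Qed.

Lemma wirtinger_sum (I : Type) (r : seq I) (F : I -> 'cV[R[i]]_m -> R[i])
    (A B : I -> 'I_m -> R[i]) z :
  (forall j, has_wirtinger (F j) z (A j) (B j)) ->
  has_wirtinger (fun w => \sum_(j <- r) F j w) z
    (fun k => \sum_(j <- r) A j k) (fun k => \sum_(j <- r) B j k).
Proof.
move=> h; elim: r => [|j r IHr].
  under eq_fun do rewrite big_nil.
  by apply: (wirtinger_eq (wirtinger_cst 0 z)) => k; rewrite big_nil.
under eq_fun do rewrite big_cons.
by apply: (wirtinger_eq (wirtingerD (h j) IHr)) => k; rewrite big_cons.
Qed.

Lemma wirtingerV f z a b : f z != 0 -> has_wirtinger f z a b ->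
  has_wirtinger (fun w => (f w)^-1) z
    (fun k => - a k / f z ^+ 2) (fun k => - b k / f z ^+ 2).
Proof.
move=> fz hf v.
have := curve_deriveV _ (hf v); rewrite scale0r addr0 => /(_ fz).
suff -> : - (\sum_k a k * v k 0 + \sum_k b k * (v k 0)^*%C) / f z ^+ 2 =
  \sum_k (- a k / f z ^+ 2) * v k 0 + \sum_k (- b k / f z ^+ 2) * (v k 0)^*%C by [].
rewrite mulNr mulrDl opprD -!mulNr -!sumrN !mulr_suml.
by congr (_ + _); apply: eq_bigr => k _; rewrite -!mulNr mulrAC.
Qed.

Lemma wirtinger_ln f z a b : (forall w, complex.Im (f w) = 0) ->
  0 < complex.Re (f z) -> has_wirtinger f z a b ->
  has_wirtinger (fun w => (ln (complex.Re (f w)))%:C) z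
    (fun k => a k / f z) (fun k => b k / f z).
Proof.
move=> fR fz hf v.
have := curve_derive_ln _ (hf v); rewrite scale0r addr0 => /(_ fz).
set l := _ + _.
(* The logarithm rule yields only [Re l]; but [l] is real, being the derivative of a real-valued
   curve. *)
have lR : complex.Im l = 0.
  have [_ [_ <-]] := hf v.
  under eq_fun do rewrite fR.
  exact: derive_cst.
have RE (x : R[i]) : complex.Im x = 0 -> (complex.Re x)%:C = x.
  by case: x => x y /= ->.
rewrite fmorph_div /= !RE // mulrDl !mulr_suml.
under eq_bigr do rewrite mulrAC.
by under [X in _ + X]eq_bigr do rewrite mulrAC.
Qed.

Lemma near_line_open (D : set 'cV[R[i]]_m) z v : open D -> D z ->
  \forall t \near (0 : R), D (z + t%:C *: v).
Proof.
move=> oD Dz; have /nbhs_normP[e /= e0 zD] := open_nbhs_nbhs (conj oD Dz).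
have Re_ge0 (x : R[i]) : 0 <= x -> x = (complex.Re x)%:C.
  by move=> /ger0_Im; case: x => a b /= ->.
have eE := Re_ge0 _ (ltW e0); have vE := Re_ge0 _ (normr_ge0 v).
have v0 : 0 <= complex.Re `|v| by rewrite -ler0c -vE.
have e0' : 0 < complex.Re e by rewrite -ltcR -eE.
(* Norms and radii live in [R[i]], whence the real parts; the [+ 1] covers [v = 0]. *)
have d0 : 0 < complex.Re e / (complex.Re `|v| + 1) by rewrite divr_gt0 ?ltr_wpDl.
apply: filterS (nbhs0_lt d0) => t ht; apply: zD.
rewrite /= opprD addNKr normrN normrZ normc_def /= expr0n /= addr0 sqrtr_sqr vE eE.
rewrite -rmorphM ltcR (@le_lt_trans _ _ (`|t| * (complex.Re `|v| + 1))) //.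
  by rewrite ler_wpM2l // lerDl.
by rewrite -ltr_pdivlMr // ltr_wpDl.
Qed.

End Wirtinger.

(** * The Bergman metric of the ball and Moebius maps *)

(** The same unipotent factor makes the block matrix with rows [(1, -u)] and [(v, 1)] block
    triangular, whether it multiplies on the right or on the left; the two diagonals give the two
    sides. *)
Lemma det_rank1 (F : comRingType) p (u : 'cV[F]_p) (v : 'rV[F]_p) :
  \det (1%:M + u *m v) = 1 + (v *m u) 0 0.
Proof.
have e1 : block_mx 1%:M (- u) v 1%:M *m block_mx 1%:M 0 (- v) 1%:M =
   block_mx (1%:M + u *m v) (- u) 0 (1%:M : 'M[F]_1).
  rewrite mulmx_block !mul1mx !mulmx1 !mulmx0 !add0r.
  by rewrite mulmxN mulNmx opprK subrr.
have e2 : block_mx 1%:M 0 (- v) 1%:M *m block_mx 1%:M (- u) v 1%:M =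
   block_mx (1%:M) (- u) 0 (1%:M + v *m u).
  rewrite mulmx_block !mul1mx !mulmx1 !mul0mx !addr0.
  by rewrite mulmxN mulNmx opprK addNr addrC.
have := congr1 determinant e1; have := congr1 determinant e2.
rewrite !det_mulmx !det_ublock !det_lblock !det1 !mul1r !mulr1 => -> <-.
by rewrite det_mx11 !mxE.
Qed.

(** * The defining function of the ball and its Bergman metric *)

Section Ball.
Context {R : realType} {m : nat}.
Implicit Types (z v w : 'cV[R[i]]_m).

(** The function [s] of the overview, taken in [R[i]] so that the Wirtinger calculus applies to
    it. *)
Definition defect z : R[i] := 1 - \sum_k z k 0 * (z k 0)^*%C.

Lemma mulcJ (x : R[i]) : x * x^*%C = (complex.Re x ^+ 2 + complex.Im x ^+ 2)%:C.
Proof.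
by case: x => a b; apply/eqP; rewrite eq_complex /=; apply/andP; split; apply/eqP; ring.
Qed.

Lemma defectE z : defect z = (1 - sqnorm z)%:C.
Proof.
rewrite /defect /sqnorm rmorphB rmorph1 rmorph_sum /=; congr (_ - _).
by apply: eq_bigr => k _; rewrite mulcJ.
Qed.

Lemma defect_gt0 z : unit_ball z -> 0 < complex.Re (defect z).
Proof. by rewrite defectE /= subr_gt0. Qed.

Lemma defect_ltr0 z : unit_ball z -> 0 < defect z.
Proof. by move=> zB; rewrite defectE ltcR subr_gt0. Qed.

Lemma defect_neq0 z : unit_ball z -> defect z != 0.
Proof.
by move=> /defect_gt0; apply: contraTneq => ->; rewrite ltxx.
Qed.

Lemma wirtinger_defect z :
  has_wirtinger defect z (fun k => - (z k 0)^*%C) (fun k => - z k 0).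
Proof.
have h j : has_wirtinger (fun w : 'cV[R[i]]_m => w j 0 * (w j 0)^*%C) z
    (fun k => (j == k)%:R * (z k 0)^*%C) (fun k => (j == k)%:R * z k 0).
  apply: (wirtinger_eq (wirtinger_normsq (wirtinger_coord j z))) => k.
    by rewrite mulrC; have [->|] := eqVneq j k; rewrite ?mul0r.
  by cbv beta; rewrite rmorph_nat mulrC; have [->|] := eqVneq j k; rewrite ?mul0r.
have hs := wirtinger_cstM (-1) (wirtinger_sum (index_enum _) h).
have := wirtingerD (wirtinger_cst 1 z) hs.
under [X in has_wirtinger X]eq_fun do rewrite mulN1r.
move/wirtinger_eq; apply => k /=.
  rewrite add0r mulN1r (bigD1 k) //= eqxx mul1r big1 ?addr0 // => j /negPf ->.
  by rewrite mul0r.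
rewrite add0r mulN1r (bigD1 k) //= eqxx mul1r big1 ?addr0 // => j /negPf ->.
by rewrite mul0r.
Qed.

Lemma near_line_ball z v : unit_ball z ->
  \forall t \near (0 : R), unit_ball (z + t%:C *: v).
Proof.
move=> zB; have [+ _] := curve_derive_continuous (wirtinger_defect z v).
move=> /cvgr_gt /(_ 0); rewrite scale0r addr0 => /(_ (defect_gt0 zB)).
by apply: filterS => t /=; rewrite defectE /= subr_gt0.
Qed.

Lemma dzbar_ln_ball z j : unit_ball z ->
  dzbar j (fun w => (ln (1 - sqnorm w))%:C) z = - z j 0 / defect z.
Proof.
move=> zB.
have -> : (fun w => (ln (1 - sqnorm w))%:C) =
    (fun w : 'cV[R[i]]_m => (ln (complex.Re (defect w)))%:C).
  by apply/funext => w; rewrite defectE.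
have defectR (w : 'cV[R[i]]_m) : complex.Im (defect w) = 0 by rewrite defectE.
exact: dzbar_wirtinger _ (wirtinger_ln defectR (defect_gt0 zB) (wirtinger_defect z)).
Qed.

Lemma bergman_ballE z : unit_ball z ->
  bergman_ball z = ((m.+1)%:R / defect z) *:
   (1%:M + (defect z)^-1 *: (map_mx conjc z *m z^T)).
Proof.
move=> zB; apply/matrixP => i j; rewrite !mxE big_ord_recl big_ord0 addr0 !mxE.
suff -> : dz i (dzbar j (fun w => (ln (1 - sqnorm w))%:C)) z =
    - ((i == j)%:R / defect z + (z i 0)^*%C * z j 0 / defect z ^+ 2).
  by field; apply: defect_neq0.
have h := wirtingerV (defect_neq0 zB) (wirtinger_defect z).
have h2 := wirtinger_cstM (-1) (wirtingerM (wirtinger_coord j z) h).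
(* The first derivative equals [- z_j / s] only inside the ball, so it is replaced near [z] before
   differentiating again. *)
rewrite (dz_wirtinger i (wirtinger_near _ h2)).
  by rewrite [j == i]eq_sym opprK; field; apply: defect_neq0.
move=> v; apply: filterS (near_line_ball v zB) => t tB.
by rewrite dzbar_ln_ball // mulN1r mulNr.
Qed.

Lemma det_bergman_ball z : unit_ball z ->
  \det (bergman_ball z) = (m.+1)%:R ^+ m / defect z ^+ m.+1.
Proof.
move=> zB; have s0 := defect_neq0 zB.
rewrite bergman_ballE // detZ scalemxAl det_rank1 -scalemxAr.
(* As [|z|^2 = 1 - s], the rank-one factor contributes [1 + (1 - s) / s = 1 / s]. *)
have -> : 1 + ((defect z)^-1 *: (z^T *m map_mx conjc z)) 0 0 = (defect z)^-1.
  rewrite !mxE (_ : \sum_j _ = 1 - defect z); first by field.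
  by rewrite /defect opprB addrC subrK; apply: eq_bigr => k _; rewrite !mxE.
by rewrite exprMn exprVn exprS; field; rewrite expf_neq0.
Qed.

End Ball.

(** * The Jacobian of a Moebius map *)

Section Mobius.
Context {R : realType} {m : nat}.
Variable (M : 'M[R[i]]_(m + 1)).
Implicit Types (z v w : 'cV[R[i]]_m).

Lemma wirtinger_affine p (N : 'M[R[i]]_(p, m + 1)) i z :
  has_wirtinger (fun w => (N *m col_mx w 1%:M) i 0) z
    (fun k => N i (lshift 1 k)) (fun=> 0).
Proof.
have h j := wirtinger_cstM (N i (lshift 1 j)) (wirtinger_coord j z).
have := wirtingerD (wirtinger_sum (index_enum _) h)
  (wirtinger_cst (N i (rshift m 0)) z).
rewrite (_ : (fun w => _) = (fun w => (N *m col_mx w 1%:M) i 0)).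
  move/wirtinger_eq; apply => k /=; rewrite addr0.
    rewrite (bigD1 k) //= eqxx mulr1 big1 ?addr0 // => j /negPf ->.
    by rewrite mulr0.
  by rewrite big1 // => j _; rewrite mulr0.
apply/funext => w; rewrite [RHS]mxE big_split_ord big_ord1 /=; congr (_ + _).
  by apply: eq_bigr => j _; rewrite col_mxEu.
by rewrite col_mxEd mxE mulr1.
Qed.

(** The quotient rule for [p / q] in matrix form; rows index components and columns index
    variables. *)
Definition mobius_jac z : 'M[R[i]]_m :=
  (mobius_den M z)^-1 *:
   (ulsubmx M - (mobius_den M z)^-1 *: (mobius_num M z *m dlsubmx M)).

Lemma wirtinger_mobius z k : mobius_den M z != 0 ->
  has_wirtinger (fun w => mobius M w k 0) z (mobius_jac z k) (fun=> 0).
Proof.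
move=> q0.
have h1 := wirtinger_affine M (rshift m 0) z.
have h2 := wirtinger_affine M (lshift 1 k) z.
have := wirtingerM h2 (wirtingerV q0 h1).
rewrite (_ : (fun w => _) = (fun w => mobius M w k 0)); last first.
  by apply/funext => w; rewrite !mxE.
move/wirtinger_eq; apply => i; last by rewrite oppr0 mul0r !mulr0 addr0.
rewrite !mxE big_ord1 !mxE -/(mobius_den M z).
rewrite [\sum_(j < m + 1) _](_ : _ = (M *m col_mx z 1%:M) (lshift 1 k) 0); last by rewrite mxE.
by field.
Qed.

Lemma mulmx_hom z : M *m col_mx z 1%:M = col_mx (mobius_num M z) (mobius_den M z)%:M.
Proof.
rewrite -[LHS]vsubmxK; congr col_mx; apply/matrixP => i j.
by rewrite !ord1 [LHS]mxE [RHS]mxE mulr1n.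
Qed.

(** Unimodular column operations on [M] first put [(p, q)] in the last column and then clear the
    rest of the last row. What remains has diagonal blocks [q J] and [q], so
    [det M = q^(m+1) det J]. *)
Lemma det_mobius_jac z : mobius_den M z != 0 ->
  \det (mobius_jac z) = \det M / mobius_den M z ^+ m.+1.
Proof.
move=> q0; set q := mobius_den M z; set p := mobius_num M z.
have e1 : M *m block_mx 1%:M z 0 1%:M = block_mx (ulsubmx M) p (dlsubmx M) q%:M.
  have := mulmx_hom z; rewrite -{1}[M]submxK mul_block_col !mulmx1 => /eq_col_mx[e f].
  by rewrite -{1}[M]submxK mulmx_block !mulmx1 !mulmx0 !addr0 e f.
have e2 : block_mx (ulsubmx M) p (dlsubmx M) q%:M *m
     block_mx 1%:M 0 (- q^-1 *: dlsubmx M) 1%:M =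
   block_mx (ulsubmx M - q^-1 *: (p *m dlsubmx M)) p 0 q%:M.
  rewrite mulmx_block !mulmx1 !mulmx0 !add0r -!scalemxAr scaleNr mul_scalar_mx.
  by rewrite scaleNr scalerA mulVf // scale1r subrr.
have := congr1 determinant e2; rewrite -e1 !det_mulmx !det_ublock !det_lblock !det1.
rewrite det_scalar1 !mulr1 => E.
rewrite /mobius_jac detZ E exprVn exprS -/q -/p. by field; rewrite expf_neq0.
Qed.

End Mobius.

(** * The defining function of the ball carried over to the image *)

Section MobiusInverse.
Context {R : realType} {m : nat}.
Variable (M : 'M[R[i]]_(m + 1)).
Hypothesis Mu : M \in unitmx.
Implicit Types (z v w : 'cV[R[i]]_m).

Let N := invmx M.

Lemma mobius_hom z : mobius_den M z != 0 ->
  M *m col_mx z 1%:M = mobius_den M z *: col_mx (mobius M z) 1%:M.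
Proof.
move=> q0; rewrite mulmx_hom scale_col_mx scalemx1; congr col_mx.
by apply/matrixP => i j; rewrite ord1 [RHS]mxE [X in _ * X]mxE mulrC divfK.
Qed.

Lemma inv_hom z : mobius_den M z != 0 ->
  N *m col_mx (mobius M z) 1%:M = (mobius_den M z)^-1 *: col_mx z 1%:M.
Proof.
move=> q0; apply: (scalerI q0); rewrite scalerA divff // scale1r.
by rewrite scalemxAr -mobius_hom // mulKmx.
Qed.

Lemma den_inv z : mobius_den M z != 0 ->
  mobius_den N (mobius M z) = (mobius_den M z)^-1.
Proof.
by move=> q0; rewrite {1}/mobius_den inv_hom // mxE col_mxEd mxE eqxx mulr1.
Qed.

Lemma num_inv z : mobius_den M z != 0 ->
  mobius_num N (mobius M z) = (mobius_den M z)^-1 *: z.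
Proof.
by move=> q0; rewrite /mobius_num inv_hom // scale_col_mx col_mxKu.
Qed.

(** The Hermitian form of signature [(1, m)] defining the ball, evaluated at [N (w, 1)]. It is a
    polynomial in [w] and its conjugate, so it can be differentiated in the coordinates of the
    image. *)
Definition rho w : R[i] := mobius_den N w * (mobius_den N w)^*%C -
  \sum_i mobius_num N w i 0 * (mobius_num N w i 0)^*%C.

Lemma rho_mobius z : mobius_den M z != 0 ->
  rho (mobius M z) = defect z / (mobius_den M z * (mobius_den M z)^*%C).
Proof.
move=> q0; rewrite /rho num_inv // den_inv // /defect mulrBl mul1r invfM fmorphV /=.
congr (_ - _); rewrite mulr_suml; apply: eq_bigr => i _.
by rewrite mxE rmorphM fmorphV /= mulrACA mulrC.
Qed.

Lemma Im_rho w : complex.Im (rho w) = 0.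
Proof.
rewrite /rho mulcJ; under eq_bigr do rewrite mulcJ.
by rewrite -rmorph_sum -rmorphB.
Qed.

Definition drho w : 'rV[R[i]]_m := (mobius_den N w)^*%C *: dlsubmx N -
  (map_mx conjc (mobius_num N w))^T *m ulsubmx N.

Lemma drhoE w k : drho w 0 k =
  (mobius_den N w)^*%C * N (rshift m 0) (lshift 1 k) -
  \sum_i (mobius_num N w i 0)^*%C * N (lshift 1 i) (lshift 1 k).
Proof.
rewrite [LHS]mxE [X in X + _ = _]mxE [X in _ * X]mxE [X in _ * X]mxE.
congr (_ + _); rewrite [LHS]mxE [X in - X = _]mxE; congr (- _).
by apply: eq_bigr => i _; congr (_ * _); rewrite !mxE.
Qed.

Lemma wirtinger_rho w :
  has_wirtinger rho w (fun k => drho w 0 k) (fun k => (drho w 0 k)^*%C).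
Proof.
have hn i := wirtinger_normsq (wirtinger_affine N i w).
have := wirtingerD (hn (rshift m 0)) (wirtinger_cstM (-1)
  (wirtinger_sum (index_enum _) (fun i => hn (lshift 1 i)))).
rewrite (_ : (fun w => _) = rho).
  have numE i : (N *m col_mx w 1%:M) (lshift 1 i) 0 = mobius_num N w i 0.
    by rewrite [RHS]mxE.
  move/wirtinger_eq; apply => k; rewrite drhoE mulN1r.
    by congr (_ - _); apply: eq_bigr => i _; rewrite numE.
  rewrite rmorphB rmorphM /= conjcK; congr (_ - _).
  by rewrite rmorph_sum; apply: eq_bigr => i _; rewrite rmorphM /= conjcK numE.
apply/funext => x; rewrite mulN1r /rho; congr (_ - _); apply: eq_bigr => i _.
by rewrite [in RHS]/mobius_num ![usubmx _ _ _]mxE.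
Qed.

(** Both sides are the holomorphic gradient of [s / |q|^2]. In place of the chain rule, the identity
    that differentiating [inv_hom] would give is checked algebraically. *)
Lemma drho_jac z : mobius_den M z != 0 ->
  drho (mobius M z) *m mobius_jac M z =
  - (mobius_den M z * (mobius_den M z)^*%C)^-1 *:
    ((map_mx conjc z)^T + (defect z / mobius_den M z) *: dlsubmx M).
Proof.
move=> q0; set q := mobius_den M z; set c := dlsubmx M; set J := mobius_jac M z.
(* [X] and [Y] are the Jacobians of [z / q] and [1 / q], the two blocks of [N (G z, 1)]. *)
pose X : 'M[R[i]]_m := q^-1 *: (1%:M - q^-1 *: (z *m c)).
pose Y : 'rV[R[i]]_m := - q ^- 2 *: c.
have XY : col_mx X Y = q^-1 *: (col_mx 1%:M 0 - q^-1 *: (col_mx z 1%:M *m c)).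
  rewrite mul_col_mx mul1mx scale_col_mx opp_col_mx add_col_mx scale_col_mx.
  by congr col_mx; rewrite sub0r scalerN scalerA -expr2 exprVn -scaleNr.
have MXY : col_mx J 0 = M *m col_mx X Y.
  rewrite [in RHS]XY -scalemxAr mulmxBr -scalemxAr mulmxA mulmx_hom.
  rewrite -{1}[M]submxK mul_block_col !mulmx1 !mulmx0 !addr0 mul_col_mx.
  rewrite scale_col_mx opp_col_mx add_col_mx scale_col_mx.
  by rewrite mul_scalar_mx scalerA mulVf // scale1r subrr scaler0.
have EJ : N *m col_mx J 0 = col_mx X Y by apply: etrans (congr1 (mulmx N) MXY) (mulKmx _ _).
move: EJ; rewrite -[N]submxK mul_block_col !mulmx0 !addr0 => /eq_col_mx[E1 E2].
rewrite /drho mulmxBl -scalemxAl -mulmxA.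
rewrite E1 E2 /X /Y den_inv // num_inv //.
have -> : (map_mx conjc (q^-1 *: z))^T = (q^*%C)^-1 *: (map_mx conjc z)^T.
  by apply/matrixP => i j; rewrite !mxE rmorphM fmorphV.
rewrite -/q fmorphV /= -scalemxAl -scalemxAr mulmxBr mulmx1 -scalemxAr mulmxA.
have -> : (map_mx conjc z)^T *m z = (1 - defect z)%:M.
  apply/matrixP => i j; rewrite !ord1 !mxE mulr1n /defect opprB addrC subrK.
  by apply: eq_bigr => k _; rewrite !mxE mulrC.
rewrite mul_scalar_mx; apply/matrixP => i j; rewrite ord1 !mxE.
by field; rewrite conjc_eq0 q0.
Qed.

End MobiusInverse.

(** * The norm of the gradient *)

Section Metric.
Context {R : realType} {m : nat}.
Variables (M : 'M[R[i]]_(m + 1)) (Omega : set 'cV[R[i]]_m).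
Variables (G : 'cV[R[i]]_m -> 'cV[R[i]]_m) (g : 'cV[R[i]]_m -> 'M[R[i]]_m).
Hypothesis Mu : M \in unitmx.
Implicit Types (z w : 'cV[R[i]]_m).
Hypothesis openO : open Omega.
Hypothesis surjG : forall w, Omega w -> exists2 z, unit_ball z & G z = w.
Hypothesis GO : forall z, unit_ball z -> Omega (G z).
Hypothesis qB : forall z, unit_ball z -> mobius_den M z != 0.
Hypothesis GM : forall z, unit_ball z -> G z = mobius M z.
Hypothesis pullG : forall z, unit_ball z -> pullback G g z = bergman_ball z.

Lemma pullbackE z : unit_ball z ->
  pullback G g z = (mobius_jac M z)^T *m g (G z) *m map_mx conjc (mobius_jac M z).
Proof.
move=> zB.
have hG k i : dz i (fun w => G w k 0) z = mobius_jac M z k i.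
  apply: dz_wirtinger; apply: wirtinger_near _ (wirtinger_mobius k (qB zB)) => v.
  by apply: filterS (near_line_ball v zB) => t /GM ->.
apply/matrixP => i j; rewrite [LHS]mxE [RHS]mxE exchange_big; apply: eq_bigr => l _.
rewrite [X in _ = X * _]mxE [X in _ = _ * X]mxE mulr_suml; apply: eq_bigr => k _.
rewrite [X in _ = X * _ * _]mxE !hG.
by rewrite [g _ _ _ * _]mulrC.
Qed.

Lemma rho_gt0 z : unit_ball z -> 0 < rho M (G z).
Proof.
move=> zB; rewrite GM // rho_mobius ?qB // divr_gt0 ?defect_ltr0 //.
by rewrite -[(mobius_den M z)^*%C]/(Num.conj _) mul_conjC_gt0 qB.
Qed.

Lemma det_unit : \det M != 0.
Proof. by rewrite -unitfE -unitmxE. Qed.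

(** Determinants in the pullback identity give [|det M|^2 / |q|^(2(m+1)) * det g = (m+1)^m /
    s^(m+1)], and [s / |q|^2] is [rho] at [G z]. *)
Lemma det_metric z : unit_ball z -> \det (g (G z)) =
  (m.+1)%:R ^+ m / (\det M * (\det M)^*%C) / rho M (G z) ^+ m.+1.
Proof.
move=> zB; have q0 := qB zB; have s0 := defect_neq0 zB.
have := congr1 determinant (pullbackE zB).
rewrite pullG // det_bergman_ball // !det_mulmx det_tr det_map_mx /=.
rewrite det_mobius_jac // fmorph_div /= rmorphXn /= [X in rho M X]GM // rho_mobius //.
have d0 := det_unit.
have dc0 : (\det M)^*%C != 0 by rewrite conjc_eq0.
have qc0 : (mobius_den M z)^*%C != 0 by rewrite conjc_eq0.
rewrite expr_div_n exprMn.
set q := mobius_den M z ^+ _; set qc := (_^*%C) ^+ _; set s := defect z ^+ _.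
set dc := (\det M)^*%C; set d := \det (g _) => E.
have -> : (m.+1)%:R ^+ m = \det M / q * d * (dc / qc) * s.
  by rewrite -E; rewrite mulrVK // unitfE expf_neq0.
by rewrite /q /qc /s; field; rewrite !expf_neq0 // d0 dc0.
Qed.

Lemma logdetE : exists k : R[i], forall w, Omega w ->
  logdet g w = k - (m.+1)%:R * (ln (complex.Re (rho M w)))%:C.
Proof.
pose K : R := m.+1%:R ^+ m / complex.Re (\det M * (\det M)^*%C).
have KE : K%:C = m.+1%:R ^+ m / (\det M * (\det M)^*%C).
  by rewrite /K mulcJ fmorph_div rmorphXn rmorph_nat.
have K0 : 0 < K.
  rewrite -ltcR KE divr_gt0 // ?exprn_gt0 ?ltr0n //.
  by rewrite -[(\det M)^*%C]/(Num.conj _) mul_conjC_gt0 det_unit.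
exists (ln K)%:C => w /surjG[z zB <-].
rewrite /logdet det_metric // -KE; have := rho_gt0 zB.
(* Positivity in [R[i]] includes being real, so [rho] becomes a real [r] to which the laws of [ln]
   apply. *)
case: (rho M (G z)) => r y; rewrite ltcE /= => /andP[/eqP -> r0].
rewrite (_ : _ +i* _ = r%:C) // -rmorphXn -fmorphV -rmorphM /=.
rewrite lnM ?posrE ?invr_gt0 ?exprn_gt0 // lnV ?posrE ?exprn_gt0 // lnXn //.
by rewrite rmorphB rmorphMn /= mulr_natl.
Qed.

Lemma wirtinger_logdet w : Omega w ->
  has_wirtinger (logdet g) w
    (fun k => - (m.+1)%:R * (drho M w 0 k / rho M w))
    (fun k => - (m.+1)%:R * ((drho M w 0 k)^*%C / rho M w)).
Proof.
move=> Ow; have [K hK] := logdetE.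
have r0 : 0 < complex.Re (rho M w).
  by case: (surjG Ow) => z zB <-; have := rho_gt0 zB; rewrite ltcE => /andP[].
have h1 := wirtinger_ln (Im_rho M) r0 (wirtinger_rho M w).
have h2 := wirtingerD (wirtinger_cst K w) (wirtinger_cstM (- m.+1%:R) h1).
apply: (wirtinger_eq (wirtinger_near _ h2)).
- move=> v; apply: filterS (near_line_open v openO Ow) => t tO.
  by rewrite hK // mulNr.
- by move=> k; rewrite add0r.
- by move=> k; rewrite add0r.
Qed.

(** The Sherman-Morrison formula: the rank-one matrix [X] built from [z] satisfies
    [X^2 = (1 - s) X], hence [(1 + X / s) (1 - X) = 1]. *)
Lemma bergman_inverse z : unit_ball z ->
  bergman_ball z *m ((defect z / (m.+1)%:R) *: (1%:M - map_mx conjc z *m z^T)) = 1%:M.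
Proof.
move=> zB; have s0 := defect_neq0 zB.
have n0 : (m.+1)%:R != 0 :> R[i] by rewrite pnatr_eq0.
rewrite bergman_ballE //; move: (m.+1%:R) n0 => n n0.
rewrite -scalemxAl -scalemxAr scalerA.
rewrite (_ : _ * _ = 1) ?scale1r; last by field; rewrite n0 s0.
have XX : (map_mx conjc z *m z^T) *m (map_mx conjc z *m z^T) =
    (1 - defect z) *: (map_mx conjc z *m z^T).
  rewrite mulmxA -[X in X *m _ = _]mulmxA.
  have -> : z^T *m map_mx conjc z = (1 - defect z)%:M.
    apply/matrixP => i j; rewrite !ord1 !mxE mulr1n /defect opprB addrC subrK.
    by apply: eq_bigr => k _; rewrite !mxE.
  by rewrite mul_mx_scalar -scalemxAl.
rewrite mulmxDl mul1mx mulmxBr mulmx1 -scalemxAl XX scalerA.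
move: (map_mx conjc z *m z^T) => X; apply/matrixP => i j; rewrite !mxE.
by field.
Qed.

Let c := dlsubmx M.
Let d := drsubmx M 0 0.

(** Writing [P] for the gradient row and [J] for the Jacobian, the norm is a Hermitian form in [P J]
    whose matrix is the inverse Bergman matrix. As [P J] combines the conjugate of [z] with [c],
    only the scalars [|z|^2 = 1 - s], [c.z = q - d] and [|c|^2] enter. *)
Lemma sqnorm_d_mobius z : unit_ball z ->
  sqnorm_d g (logdet g) (G z) = (m.+1)%:R * (1 +
   defect z * ((\sum_k c 0 k * (c 0 k)^*%C) - d * d^*%C) /
     (mobius_den M z * (mobius_den M z)^*%C)).
Proof.
move=> zB; have q0 := qB zB; have s0 := defect_neq0 zB.
have Ow := GO zB; have h := wirtinger_logdet Ow.
set w := G z in Ow h *; set q := mobius_den M z in q0 *; set s := defect z in s0 *.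
set J := mobius_jac M z.
pose P : 'rV[R[i]]_m := (- (m.+1)%:R / rho M w) *: drho M w.
have sR : s^*%C = s by rewrite /s defectE conjc_real.
have rR : (rho M w)^*%C = rho M w.
  by rewrite /w GM // rho_mobius // rmorphM fmorphV rmorphM /= sR conjcK [_ * q]mulrC.
have PE k : P 0 k = - (m.+1)%:R * (drho M w 0 k / rho M w).
  by rewrite mxE mulrAC mulrA.
have PcE k : (map_mx conjc P)^T k 0 = - (m.+1)%:R * ((drho M w 0 k)^*%C / rho M w).
  rewrite [LHS]mxE [LHS]mxE PE rmorphM rmorphN rmorph_nat /=; congr (_ * _).
  by rewrite rmorphM fmorphV /= rR.
have -> : sqnorm_d g (logdet g) w = (P *m (invmx (g w))^T *m (map_mx conjc P)^T) 0 0.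
  rewrite /sqnorm_d mxE exchange_big; apply: eq_bigr => j _.
  rewrite [X in _ = X * _]mxE mulr_suml; apply: eq_bigr => k _.
  by rewrite (dz_wirtinger _ h) (dzbar_wirtinger _ h) -PE -PcE [_^T _ _ * _]mulrC.
set n1 : R[i] := (m.+1)%:R.
set Bi := (s / n1) *: (1%:M - map_mx conjc z *m z^T).
have gB : invmx (g w) = map_mx conjc J *m Bi *m J^T.
  have JB : g w *m (map_mx conjc J *m Bi *m J^T) = 1%:M.
    (* A product of square matrices equal to [1] may be commuted, so [J^T] moves to the front and
       the pullback identity appears. *)
    rewrite 2!mulmxA; apply: mulmx1C; rewrite !mulmxA -pullbackE //.
    by rewrite pullG // bergman_inverse.
  by rewrite -[RHS](mulKmx (mulmx1_unit JB).1) JB mulmx1.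
have PJ : P *m J = n1 *: (s^-1 *: (map_mx conjc z)^T + q^-1 *: c).
  rewrite /P -scalemxAl /w GM // drho_jac ?qB // rho_mobius ?qB // -/s -/q.
  rewrite scalerA -[in LHS](scale1r (map_mx _ _)^T).
  apply/matrixP => i j; rewrite !mxE; field.
  by rewrite s0 q0 conjc_eq0 q0.
have n0 : n1 != 0 by rewrite pnatr_eq0.
rewrite gB !trmx_mul trmxK !mulmxA -(mulmxA (P *m J *m Bi^T)) -trmx_mul -map_mxM PJ.
set qc := q^*%C; set dc := d^*%C.
have qc0 : qc != 0 by rewrite conjc_eq0.
pose zc := (map_mx conjc z)^T; pose cc := (map_mx conjc c)^T.
have -> : (map_mx conjc (n1 *: (s^-1 *: (map_mx conjc z)^T + q^-1 *: c)))^T =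
    n1 *: (s^-1 *: z + qc^-1 *: cc).
  apply/matrixP => i j; rewrite !ord1 !mxE !(rmorphM, rmorphD) !fmorphV /=.
  by rewrite rmorph_nat sR conjcK.
have -> : Bi^T = (s / n1) *: (1%:M - z *m zc).
  by rewrite linearZ /= linearB /= trmx1 trmx_mul trmxK.
have zz : zc *m z = (1 - s)%:M.
  apply/matrixP => i j; rewrite !ord1 !mxE mulr1n /s /defect opprB addrC subrK.
  by apply: eq_bigr => k _; rewrite !mxE mulrC.
have cz : c *m z = (q - d)%:M.
  have := congr1 dsubmx (mulmx_hom M z); rewrite -{1}[M]submxK mul_block_col !mulmx1 !col_mxKd.
  rewrite -/c -/q => /(canRL (addrK _)) ->; rewrite raddfB /=; congr (_ - _).
  by apply/matrixP => i j; rewrite !ord1 [RHS]mxE mulr1n.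
have zcc : zc *m cc = (qc - dc)%:M.
  by rewrite -trmx_mul -map_mxM cz map_scalar_mx tr_scalar_mx rmorphB.
set c2 := \sum_k _.
have ccc : c *m cc = c2%:M.
  apply/matrixP => i j; rewrite !ord1 [LHS]mxE [RHS]mxE mulr1n.
  by apply: eq_bigr => k _; rewrite [cc _ _]mxE [map_mx _ _ _ _]mxE.
set u := s^-1 *: zc + q^-1 *: c; set v := s^-1 *: z + qc^-1 *: cc.
have uz : u *m z = (s^-1 * (1 - s) + q^-1 * (q - d))%:M.
  by rewrite mulmxDl -!scalemxAl zz cz !scale_scalar_mx -raddfD.
have zv : zc *m v = (s^-1 * (1 - s) + qc^-1 * (qc - dc))%:M.
  by rewrite mulmxDr -!scalemxAr zz zcc !scale_scalar_mx -raddfD.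
have cv : c *m v = (s^-1 * (q - d) + qc^-1 * c2)%:M.
  by rewrite mulmxDr -!scalemxAr cz ccc !scale_scalar_mx -raddfD.
have uv : u *m v = (s^-1 * (s^-1 * (1 - s) + qc^-1 * (qc - dc)) +
    q^-1 * (s^-1 * (q - d) + qc^-1 * c2))%:M.
  by rewrite mulmxDl -!scalemxAl zv cv !scale_scalar_mx -raddfD.
rewrite -!scalemxAl -!scalemxAr -!scalemxAl mulmxBr mulmx1 mulmxBl mulmxA uz -mulmxA zv uv.
rewrite -scalar_mxM -raddfB !scale_scalar_mx mxE mulr1n.
by clearbody n1; field; rewrite s0 q0 qc0 n0.
Qed.

End Metric.

(** * Reduction to the Cayley transform *)

(** Gram-Schmidt applied to the matrix with all rows equal to [u] completes [u] to an orthonormal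
    basis; reversing the rows moves [u] from first to last. *)
Lemma unitary_last_row (C : numClosedFieldType) n (u : 'rV[C]_n.+1) :
  dotmx u u = 1 -> exists2 V : 'M[C]_n.+1, V \is unitarymx & row ord_max V = u.
Proof.
move=> u1; pose A : 'M[C]_n.+1 := \matrix_(i < n.+1) u.
have rA i : row i A = u by rewrite rowK.
have SU : schmidt A \is unitarymx by rewrite schmidt_unitarymx.
have S0 : row ord0 (schmidt A) = u.
  have := row_schmidt_sub A ord0.
  rewrite (big_pred1 ord0); last by move=> i; rewrite /= leqn0.
  rewrite genmxE rA => /sub_rVP[a ua].
  have S1 : dotmx (row ord0 (schmidt A)) (row ord0 (schmidt A)) = 1.
    by have /row_unitarymxP -> := SU; rewrite eqxx.
  (* Gram-Schmidt makes [a] nonnegative, so [|a| = 1] leaves only [a = 1]. *)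
  have := form1_row_schmidt A ord0; rewrite rA {1}ua linearZl_LR /= S1 mulr1 => a0.
  move: u1; rewrite ua linearZl_LR /= linearZr_LR /= S1 mulr1 => aa.
  suff -> : a = 1 by rewrite scale1r.
  move: aa; rewrite conj_Creal ?ger0_real // -expr2 => /eqP.
  by rewrite sqrf_eq1 => /orP[/eqP //|/eqP a1]; move: a0; rewrite a1 oppr_ge0 ler10.
exists (\matrix_i row (rev_ord i) (schmidt A)).
  apply/row_unitarymxP => i j; rewrite !rowK.
  by have /row_unitarymxP -> := SU; rewrite (inj_eq rev_ord_inj).
by rewrite rowK (_ : rev_ord _ = ord0) //; apply: val_inj; rewrite /= subnn.
Qed.

(** * The Siegel domain as the Cayley image of the ball *)

Section Cayley.
Context {R : realType} {n : nat}.
Implicit Types z w : 'cV[R[i]]_n.+1.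

Definition siegel_defect w : R[i] := (w ord_max 0 + (w ord_max 0)^*%C) / 2 -
  \sum_(i < n.+1 | i != ord_max) w i 0 * (w i 0)^*%C.

Lemma siegelE w : siegel w <-> 0 < siegel_defect w.
Proof.
rewrite /siegel /siegel_defect /=.
have -> : (w ord_max 0 + (w ord_max 0)^*%C) / 2 = (complex.Re (w ord_max 0))%:C.
  by rewrite ReJ_add.
under [X in _ <-> 0 < _ - X]eq_bigr do rewrite mulcJ.
by rewrite -rmorph_sum -rmorphB /= ltcR subr_gt0.
Qed.

(** With [t] the last coordinate, the real part of [(1 + t) / (1 - t)] is [(1 - |t|^2) / |1 - t|^2],
    and the other terms have the same denominator. *)
Lemma siegel_cayley z : z ord_max 0 != 1 ->
  siegel_defect (cayley z) =
    defect z / ((1 - z ord_max 0) * (1 - z ord_max 0)^*%C).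
Proof.
move=> z1; rewrite /siegel_defect /defect [in RHS](bigD1 ord_max) //=.
rewrite [X in _ - X = _](_ : _ = (\sum_(i < n.+1 | i != ord_max) z i 0 * (z i 0)^*%C) /
    ((1 - z ord_max 0) * (1 - z ord_max 0)^*%C)); last first.
  rewrite mulr_suml; apply: eq_bigr => i /negPf im.
  by rewrite !mxE im rmorphM fmorphV /= invfM mulrACA.
rewrite !mxE eqxx rmorphM fmorphV rmorphD rmorphB rmorph1 /=.
have z2 : 1 - z ord_max 0 != 0 by rewrite subr_eq0 eq_sym.
have z3 : 1 - (z ord_max 0)^*%C != 0.
  by rewrite -(rmorph1 (@conjc R)) -rmorphB conjc_eq0.
by field; rewrite z2 z3.
Qed.

Lemma unit_ballE z : unit_ball z <-> 0 < defect z.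
Proof. by rewrite defectE ltcR subr_gt0. Qed.

Lemma ball_coord_neq1 z : unit_ball z -> z ord_max 0 != 1.
Proof.
apply: contraPneq => z1; rewrite /unit_ball /= /sqnorm (bigD1 ord_max) //= z1 /=.
apply/negP; rewrite -leNgt expr1n expr0n addr0 lerDl.
by apply: sumr_ge0 => i _; rewrite addr_ge0 ?sqr_ge0.
Qed.

Lemma cayley_ball : [set cayley z | z in @unit_ball R n.+1] = @siegel R n.
Proof.
apply/seteqP; split => [_ [z zB <-]|w wS].
  apply/siegelE; rewrite siegel_cayley ?ball_coord_neq1 // divr_gt0 ?defect_ltr0 //.
  rewrite -[(_ - _)^*%C]/(Num.conj _) mul_conjC_gt0 subr_eq0 eq_sym.
  exact: ball_coord_neq1.
have w1 : w ord_max 0 + 1 != 0.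
  have : 0 < complex.Re (w ord_max 0).
    apply: le_lt_trans wS; apply: sumr_ge0 => i _.
    by rewrite addr_ge0 ?sqr_ge0.
  apply: contraTneq => /(canRL (addrK _)) ->; rewrite add0r /=.
  by rewrite -leNgt oppr_le0 ler01.
(* The inverse Cayley transform, from solving [(1 + t) / (1 - t) = w_n] for the last coordinate
   [t]. *)
pose z : 'cV[R[i]]_n.+1 :=
  \col_i ((if i == ord_max then w ord_max 0 - 1 else 2 * w i 0) / (w ord_max 0 + 1)).
have zm : z ord_max 0 = (w ord_max 0 - 1) / (w ord_max 0 + 1) by rewrite mxE eqxx.
have z1 : 1 - z ord_max 0 = 2 / (w ord_max 0 + 1) by rewrite zm; field.
have z0 : 1 - z ord_max 0 != 0 by rewrite z1 mulf_neq0 ?invr_eq0 ?pnatr_eq0.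
have zw : cayley z = w.
  apply/matrixP => i j; rewrite ord1 mxE z1.
  have [->|/negPf im] := eqVneq i ord_max; first by rewrite zm; field.
  by rewrite mxE im; field.
exists z => //; apply/unit_ballE; move/siegelE: wS.
rewrite -{1}zw siegel_cayley; last by rewrite eq_sym -subr_eq0.
rewrite pmulr_lgt0 // invr_gt0 -[(_ - _)^*%C]/(Num.conj _) mul_conjC_gt0 //.
Qed.

Lemma unitary_ball (U : 'M[R[i]]_n.+1) z : U \is unitarymx ->
  unit_ball (U *m z) <-> unit_ball z.
Proof.
move=> UU.
have dE w : defect w = 1 - ((map_mx conjc w)^T *m w) 0 0.
  by rewrite /defect mxE; congr (_ - _); apply: eq_bigr => k _; rewrite !mxE mulrC.
rewrite !unit_ballE !dE map_mxM trmx_mul mulmxA -[X in X *m z]mulmxA.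
have -> : (map_mx conjc U)^T *m U = 1%:M.
  by have /unitarymxP/mulmx1C := UU; rewrite map_trmx.
by rewrite mulmx1.
Qed.

End Cayley.

Lemma linear_part_norm {R : realType} {m : nat} (M : 'M[R[i]]_(m.+1 + 1)) (k : R[i]) :
  (forall z, unit_ball z -> mobius_den M z != 0) ->
  (forall z, unit_ball z ->
    defect z * (\sum_k dlsubmx M 0 k * (dlsubmx M 0 k)^*%C -
                drsubmx M 0 0 * (drsubmx M 0 0)^*%C) /
     (mobius_den M z * (mobius_den M z)^*%C) = k) ->
  \sum_k dlsubmx M 0 k * (dlsubmx M 0 k)^*%C = drsubmx M 0 0 * (drsubmx M 0 0)^*%C.
Proof.
move=> qB hk; apply/eqP; rewrite -subr_eq0; apply/negPn/negP => D0.
set D := (X in X != 0) in D0 hk; set d := drsubmx M 0 0 in D hk D0.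
have denE z : mobius_den M z = (dlsubmx M *m z) 0 0 + d.
  rewrite /mobius_den -{1}[M]submxK mul_block_col !mulmx1 col_mxEd.
  by rewrite [LHS]mxE.
have B0 : unit_ball (0 : 'cV[R[i]]_m.+1).
  by rewrite /unit_ball /= /sqnorm big1 ?ltr01 // => i _; rewrite mxE /= expr0n addr0.
have den0 : mobius_den M 0 = d by rewrite denE mulmx0 mxE add0r.
have d0 : d != 0 by rewrite -den0 qB.
have s0 : defect (0 : 'cV[R[i]]_m.+1) = 1.
  by rewrite /defect big1 ?subr0 // => i _; rewrite mxE mul0r.
have dc0 : d^*%C != 0 by rewrite conjc_eq0.
(* Comparison with the origin, where [s = 1] and [q = d]; the nonzero factor [D] cancels. *)
have E z : unit_ball z -> defect z * (d * d^*%C) = mobius_den M z * (mobius_den M z)^*%C.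
  move=> zB; have q0 := qB _ zB; have qc0 : (mobius_den M z)^*%C != 0 by rewrite conjc_eq0.
  have /eqP := hk _ zB; rewrite -(hk _ B0) s0 den0 eqr_div ?mulf_neq0 // => /eqP e.
  by apply: (mulfI D0); rewrite mulrCA mulrA e mul1r.
(* Any nonzero point of the ball would do; positive dimension provides the coordinate [0]. *)
pose z : 'cV[R[i]]_m.+1 := 2^-1 *: delta_mx 0 0.
have zs : defect z = 1 - 4^-1.
  rewrite /defect (bigD1 0) //= big1 => [|i /negPf i0].
    by rewrite !mxE !eqxx mulr1 addr0 fmorphV rmorph_nat; field.
  by rewrite !mxE i0 mulr0 mul0r.
have zN : defect (- z) = defect z.
  by rewrite /defect; congr (_ - _); apply: eq_bigr => i _; rewrite mxE rmorphN mulrNN.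
have zB : unit_ball z.
  by apply/unit_ballE; rewrite zs subr_gt0 invf_lt1 ?ltr0n // ltr1n.
have zNB : unit_ball (- z) by apply/unit_ballE; rewrite zN; apply/unit_ballE.
have denN : mobius_den M (- z) = - (dlsubmx M *m z) 0 0 + d by rewrite denE mulmxN mxE.
have := E _ zB; have := E _ zNB; rewrite zN zs denN denE.
move: ((dlsubmx M *m z) 0 0) => b e1 e2.
have dd : 0 < d * d^*%C by rewrite -[d^*%C]/(Num.conj _) mul_conjC_gt0.
have bb : 0 <= b * b^*%C by rewrite -[b^*%C]/(Num.conj _) mul_conjC_ge0.
(* The parallelogram law for [d + b] and [d - b], each of squared modulus [(1 - 1/4) |d|^2]. *)
have : b * b^*%C = - 4^-1 * (d * d^*%C).
  apply: (@mulfI _ 2); first by rewrite pnatr_eq0.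
  have := congr2 +%R e1 e2; rewrite !rmorphD rmorphN /= => e3.
  rewrite (_ : 2 * _ = (- b + d) * (- b^*%C + d^*%C) + (b + d) * (b^*%C + d^*%C) -
    2 * (d * d^*%C)); last by ring.
  by rewrite -e3; field.
move=> e; have : 0 < 4^-1 * (d * d^*%C) by rewrite mulr_gt0 // invr_gt0 ltr0n.
by rewrite -oppr_lt0 -mulNr -e le_gtF.
Qed.

Lemma mobius_cayley {R : realType} {n : nat} (M : 'M[R[i]]_(n.+1 + 1))
    (G : 'cV[R[i]]_n.+1 -> 'cV[R[i]]_n.+1) :
  M \in unitmx ->
  (forall z, unit_ball z -> mobius_den M z != 0) ->
  (forall z, unit_ball z -> G z = mobius M z) ->
  drsubmx M 0 0 != 0 ->
  \sum_k dlsubmx M 0 k * (dlsubmx M 0 k)^*%C = drsubmx M 0 0 * (drsubmx M 0 0)^*%C ->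
  exists (L : 'M[R[i]]_n.+1) (b : 'cV[R[i]]_n.+1) (U : 'M[R[i]]_n.+1),
    [/\ L \in unitmx, U \is unitarymx &
        forall z, unit_ball z -> L *m G (U *m z) + b = cayley z].
Proof.
move=> Mu qB GM; set d := drsubmx M 0 0; set c := dlsubmx M => d0 cd.
have dc0 : d^*%C != 0 by rewrite conjc_eq0.
pose e : 'rV[R[i]]_n.+1 := delta_mx 0 ord_max.
(* The row [- c / d] is a unit vector because [|c| = |d|]; the adjoint [U] of [V] then sends [c] to
   [- d e], so the denominator of [G] after [U] is [d (1 - z_n)]. *)
have [V VU Vu] : exists2 V : 'M[R[i]]_n.+1, V \is unitarymx & row ord_max V = - d^-1 *: c.
  apply: unitary_last_row; rewrite dotmxE mxE.
  rewrite (_ : \sum_j _ = (\sum_k c 0 k * (c 0 k)^*%C) / (d * d^*%C)).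
    by rewrite cd divff // mulf_neq0.
  rewrite mulr_suml; apply: eq_bigr => k _; rewrite !mxE.
  rewrite -[Num.conj _]/((_ * _)^*%C) rmorphM rmorphN fmorphV /=; field.
  by rewrite d0 dc0.
pose U := (V ^t*)%sesqui.
have VUt : V *m U = 1%:M by apply/unitarymxP.
have UU : U \is unitarymx by rewrite trmxC_unitary.
have cU : c *m U = - d *: e.
  have -> : c = - d *: row ord_max V by rewrite Vu scalerA mulrNN divff // scale1r.
  by rewrite -scalemxAl -row_mul VUt row1.
pose M' := M *m block_mx U 0 0 1%:M.
have M'u : M' \in unitmx.
  rewrite unitmx_mul Mu unitmxE det_ublock det1 mulr1 -unitmxE.
  by have [] := mulmx1_unit VUt.
(* The Cayley transform is the Moebius map of K; Q is affine since K and M' have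
   proportional last rows. *)
pose K : 'M[R[i]]_(n.+1 + 1) := block_mx 1%:M e^T (- e) 1%:M.
have Ku : K \in unitmx.
  (* A unipotent factor clears the last row, and the rank-one formula gives [det K = 2]. *)
  have : K *m block_mx 1%:M 0 e 1%:M = block_mx (1%:M + e^T *m e) e^T 0 1%:M.
    by rewrite mulmx_block !mulmx1 !mul1mx !mulmx0 !add0r addNr.
  move/(congr1 determinant); rewrite det_mulmx det_lblock det_ublock !det1 !mulr1 det_rank1.
  rewrite unitmxE => ->; rewrite mxE (bigD1 ord_max) //= big1 => [|i /negPf im].
    by rewrite !mxE !eqxx mulr1 addr0 unitfE (_ : 1 + 1 = 2%:R) ?pnatr_eq0 // -natrD.
  by rewrite !mxE im andbF mul0r.
pose Q := d *: K *m invmx M'.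
have Qu : Q \in unitmx.
  by rewrite unitmx_mul unitmx_inv M'u andbT unitmxZ ?unitfE.
have dM' : dsubmx (d *: K) = dsubmx M'.
  rewrite /M' -{1}[M]submxK mulmx_block !mulmx0 !mulmx1 !add0r addr0.
  rewrite -/c cU /K scale_block_mx /block_mx !col_mxKd scalerN scaleNr; congr row_mx.
    by rewrite addr0.
  by apply/matrixP => i j; rewrite !ord1 [LHS]mxE [X in _ * X]mxE mulr1.
have dQ : dsubmx Q = row_mx 0 1%:M.
  rewrite /Q -mul_dsub_mx dM' mul_dsub_mx mulmxV // scalar_mx_block /block_mx col_mxKd.
  by [].
pose L := ulsubmx Q; pose b := ursubmx Q.
have QE : Q = block_mx L b 0 1%:M.
  rewrite -[Q]submxK; congr block_mx.
    by rewrite /dlsubmx dQ row_mxKl.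
  by rewrite /drsubmx dQ row_mxKr.
exists L, b, U; split => //.
  by move: Qu; rewrite QE !unitmxE det_ublock det1 mulr1.
move=> z zB; have UzB : unit_ball (U *m z) by apply/unitary_ball.
have q0 := qB _ UzB.
(* In homogeneous coordinates: the upper block gives [q (L G(U z) + b)] and the lower one gives
   [q = d (1 - z_n)]. *)
have E : Q *m (M' *m col_mx z 1%:M) = d *: K *m col_mx z 1%:M by rewrite mulmxA mulmxKV.
move: E; rewrite /M' -mulmxA mul_block_col !mul0mx addr0 add0r mulmx1.
rewrite (mobius_hom q0) -GM // QE -scalemxAr mul_block_col mul0mx add0r !mulmx1.
rewrite -scalemxAl mul_block_col !mul1mx mulmx1 !scale_col_mx => /eq_col_mx[E1 E2].
set q := mobius_den M (U *m z) in q0 E1 E2.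
have qE : q = d * (1 - z ord_max 0).
  have := congr1 (fun A : 'M[R[i]]_1 => A 0 0) E2; rewrite !mxE mulr1 => ->.
  congr (_ * _); rewrite addrC (bigD1 ord_max) //= !mxE !eqxx big1 => [|i /negPf im].
    by rewrite addr0 mulNr mul1r.
  by rewrite !mxE im andbF mulr0n oppr0 mul0r.
apply: (scalerI q0); rewrite E1 qE; apply/matrixP => i j; rewrite !ord1 !mxE.
have z1 : 1 - z ord_max 0 != 0 by rewrite subr_eq0 eq_sym ball_coord_neq1.
have [->|/negPf im] := eqVneq i ord_max; first by rewrite ?eqxx /=; field.
by rewrite andbF addr0 /=; field.
Qed.

Theorem theorem1p4 (R : realType) (n : nat)
    (Omega : set 'cV[R[i]]_n.+1)
    (G : 'cV[R[i]]_n.+1 -> 'cV[R[i]]_n.+1)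
    (g : 'cV[R[i]]_n.+1 -> 'M[R[i]]_n.+1)
    (domOmega : is_domain Omega)
    (biholG : biholomorphism (@unit_ball R n.+1) Omega G)
    (mobiusG : mobius_on (@unit_ball R n.+1) G)
    (ke_g : complete_kahler_einstein Omega g)
    (pullback_g : forall z, unit_ball z -> pullback G g z = bergman_ball z)
    (const_norm : exists c : R[i],
       forall z, Omega z -> norm_d g (logdet g) z = c) :
  exists (L : 'M[R[i]]_n.+1) (b : 'cV[R[i]]_n.+1) (U : 'M[R[i]]_n.+1),
    [/\ L \in unitmx,
        U \is unitarymx,
        [set L *m w + b | w in Omega] = @siegel R n &
        forall z, unit_ball z -> L *m G (U *m z) + b = cayley z].
Proof.
have [openO _ _] := domOmega; have [[GO _ surjG] _ _] := biholG.
have [M Mu hM] := mobiusG; have [k hk] := const_norm.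
have qB z : unit_ball z -> mobius_den M z != 0 by move=> /hM[].
have GM z : unit_ball z -> G z = mobius M z by move=> /hM[].
have surj w : Omega w -> exists2 z, unit_ball z & G z = w by move=> /surjG.
have B0 : unit_ball (0 : 'cV[R[i]]_n.+1).
  by rewrite /unit_ball /= /sqnorm big1 ?ltr01 // => i _; rewrite mxE /= expr0n addr0.
have d0 : drsubmx M 0 0 != 0.
  have := qB _ B0; rewrite /mobius_den -{1}[M]submxK mul_block_col !mulmx0 !mulmx1 !add0r.
  by rewrite col_mxEd.
have cd : \sum_k dlsubmx M 0 k * (dlsubmx M 0 k)^*%C =
    drsubmx M 0 0 * (drsubmx M 0 0)^*%C.
  (* The squared norm [k^2] is [(m+1)] times [1 +] the quotient in question, and here
     [m + 1 = n + 2]. *)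
  apply: (@linear_part_norm _ _ _ (k ^+ 2 / (n.+2)%:R - 1) qB) => z zB.
  have GzO : Omega (G z) by apply: GO.
  rewrite -(hk _ GzO) /norm_d sqrtCK (sqnorm_d_mobius Mu openO) //.
  by rewrite [n.+2%:R * _]mulrC mulfK ?pnatr_eq0 // addrAC subrr add0r.
have [L [b [U [Lu UU LG]]]] := mobius_cayley Mu qB GM d0 cd.
exists L, b, U; split => //; rewrite -cayley_ball; apply/seteqP; split.
  move=> _ [w /surj[z zB <-] <-].
  (* Each point [G z] of [Omega] is rewritten as [G (U v)] with [v] in the ball, so that [LG]
     applies. *)
  have Uz : U *m (invmx U *m z) = z by rewrite mulKVmx // unitarymx_unit.
  have vB : unit_ball (invmx U *m z) by rewrite -(unitary_ball _ UU) Uz.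
  by exists (invmx U *m z) => //; rewrite -LG // Uz.
move=> _ [z zB <-]; exists (G (U *m z)); last exact: LG.
by apply: GO; apply/unitary_ball.
Qed.
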